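(* Let $\Gamma$ be a vertex functional of the Abelian Higgs model (a formal power series in $\hbar$ as described in the context) that satisfies, for all values of $\xi$, the $\chi$-enlarged Slavnov-Taylor identity $$\int\Big\{\partial_\mu c\frac{\delta\Gamma}{\delta A_\mu}+B\frac{\delta\Gamma}{\delta\bar c}+\sum_{i=1,2}\Big(\frac{\delta\Gamma}{\delta Y_i}\frac{\delta\Gamma}{\delta\varphi_i}+q_i\frac{\delta\Gamma}{\delta\hat\varphi_i}\Big)\Big\}+\chi\,\partial_\xi\Gamma=0$$ and the normalization condition $\Gamma_{\varphi_1}=0$. Then, to all orders of perturbation theory, $\partial_\chi\Gamma_{Y_1}=0$, and the transversal part of the vector 2-point vertex function is independent of the gauge parameter: $$\partial_\xi\Gamma^T(p^2)=0,\qquad\text{where}\quad \Gamma_{A^\mu A^\nu}(p,-p)=\Big(\eta_{\mu\nu}-\frac{p_\mu p_\nu}{p^2}\Big)\Gamma^T(p^2)+\frac{p_\mu p_\nu}{p^2}\Gamma^L(p^2).$$ In particular the conditions $\Gamma^T(m^2)=0$ and $\partial_{p^2}\Gamma^T(\kappa_m^2)=1$, with $\xi$-independent $m$ and $\kappa_m$, are compatible with this identity.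
   Context: Fields on 4-dimensional Minkowski space: vector $A_\mu$, auxiliary field $B$, scalars $\varphi_1$ (Higgs), $\varphi_2$ (would-be Goldstone), ghosts $c,\bar c$, external fields $Y_1,Y_2$, $\hat\varphi_1,\hat\varphi_2$, $q_1,q_2$. The fields $c,\bar c,Y_i,q_i$ are anticommuting, the others commuting; functional derivatives act from the left. Faddeev-Popov charge: $c,q_i$: $+1$; $\bar c,Y_i$: $-1$; others $0$. Charge conjugation: $\varphi_1,\hat\varphi_1,Y_1,q_1$ even; $A_\mu,B,\varphi_2,\hat\varphi_2,c,\bar c,Y_2,q_2$ odd. $\chi$ is a constant Grassmann variable ($\chi^2=0$) of Faddeev-Popov charge $+1$, even under charge conjugation, the BRS variation of the gauge parameter $\xi$. The vertex functional $\Gamma=\hat\Gamma+\chi Q$ is the generating functional of one-particle-irreducible Green functions, a formal power series in $\hbar$ and in the fields, Poincaré invariant, invariant under charge conjugation, of Faddeev-Popov charge $0$, depending differentiably on $\xi$. Subscripts denote functional derivatives evaluated at vanishing fields and at $\chi=0$, Fourier transformed with the momentum-conservation delta function removed; $\partial_\chi\Gamma_{\dots}$ means that first the indicated functional derivatives are taken and then the derivative with respect to $\chi$, at $\chi=0$ and vanishing fields. In lowest order $\Gamma_{\varphi_1\varphi_1}(p^2)=p^2-m_H^2+O(\hbar)$ with $m_H>0$ (and $m_H^2<4m^2$: stable Higgs particle), where $m>0$ is the vector mass; $m,m_H$ are $\xi$-independent. *)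

(* Defs.v *)
From HB Require Import structures.
From mathcomp Require Import all_boot all_order all_algebra.
From mathcomp Require Import all_classical all_reals all_analysis.
From mathcomp Require Export complex.

Set Implicit Arguments.
Unset Strict Implicit.
Unset Printing Implicit Defensive.

Import Order.TTheory GRing.Theory Num.Theory.
Import numFieldNormedType.Exports.

Local Open Scope ring_scope.
Local Open Scope complex_scope.

(* R[i] carries no canonical normed-module structure over R, hence the
   componentwise definitions. *)
Definition cderivable (R : realType) (f : R -> R[i]) (x : R) : Prop :=
  derivable (fun t => complex.Re (f t)) x 1 /\
  derivable (fun t => complex.Im (f t)) x 1.

Definition cderive (R : realType) (f : R -> R[i]) (x : R) : R[i] :=
  (fun t => complex.Re (f t))^`()%classic x +i*
  (fun t => complex.Im (f t))^`()%classic x.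

Definition is_cderive (R : realType) (f : R -> R[i]) (x : R) (l : R[i]) :=
  cderivable f x /\ cderive f x = l.

(* A column p holds the contravariant components p^mu. *)
Definition mom (R : realType) := 'cV[R]_4.

(* Signature (+,-,-,-). *)
Definition eta (R : realType) : 'M[R]_4 :=
  \matrix_(mu, nu) (if mu == nu then (if mu == 0 then 1 else -1) else 0).

Definition lower (R : realType) (p : mom R) (mu : 'I_4) : R :=
  (eta R *m p) mu 0.

Definition mdot (R : realType) (p q : mom R) : R :=
  \sum_(mu < 4) lower p mu * q mu 0.

(* The proper orthochronous group. *)
Definition lorentz_group (R : realType) (L : 'M[R]_4) : Prop :=
  [/\ L^T *m eta R *m L = eta R, \det L = 1 & 0 < L 0 0].

(* fA mu is the contravariant component A^mu; in the doublets the ordinal 0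
   stands for the index 1 and the ordinal 1 for the index 2. *)
Inductive fld : Type :=
| fA of 'I_4 | fB | fphi of 'I_2 | fc | fcbar
| fY of 'I_2 | fhphi of 'I_2 | fq of 'I_2.

Notation phi1 := (fphi ord0).
Notation Y1 := (fY ord0).

(* Arguments of vertex functions: a field with its incoming momentum, or the
   constant Grassmann variable chi. *)
Inductive letter (R : realType) : Type := Fld of fld & mom R | Chi.
Arguments Chi {R}.

Definition fld_odd (a : fld) : bool :=
  match a with fc | fcbar | fY _ | fq _ => true | _ => false end.

Definition fld_gh (a : fld) : int :=
  match a with fc | fq _ => 1 | fcbar | fY _ => -1 | _ => 0 end.

Definition fld_Codd (a : fld) : bool :=
  match a with
  | fA _ | fB | fc | fcbar => true
  | fphi i | fY i | fhphi i | fq i => i != ord0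
  end.

(* chi is odd, of Faddeev-Popov charge +1, C-even and of momentum 0. *)
Definition grass (R : realType) (l : letter R) : bool :=
  if l is Fld a _ then fld_odd a else true.

Definition gh (R : realType) (l : letter R) : int :=
  if l is Fld a _ then fld_gh a else 1.

Definition Codd (R : realType) (l : letter R) : bool :=
  if l is Fld a _ then fld_Codd a else false.

Definition momentum (R : realType) (l : letter R) : mom R :=
  if l is Fld _ p then p else 0.

Definition ptot (R : realType) (w : seq (letter R)) : mom R :=
  \sum_(l <- w) momentum l.

(* F [:: l1; ...; lk] n xi is the coefficient of hbar^n, at gauge parameter
   xi, of the left derivative  d/dl_k ... d/dl_1 F  (l1 acting first) at
   vanishing fields and chi = 0, in momentum space.  Two kinds of objects
   share this type:
   - a translation covariant function D(x) of the point x: D w is the Fourier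
     transform of its kernels with the factor exp(i (ptot w).x) removed;
   - a translation invariant functional: the factor (2 pi)^4 delta(ptot w) is
     removed and the coefficients are set to 0 when ptot w is nonzero. *)
Definition functional (R : realType) : Type :=
  seq (letter R) -> nat -> R -> R[i].

Definition strip (R : realType) (l : letter R) (F : functional R) :
  functional R := fun w => F (l :: w).

Definition fgrade (R : realType) (l : letter R) (F : functional R) :
  functional R :=
  fun w n xi => (-1) ^+ (grass l && odd (count (@grass R) w)) * F w n xi.

(* Product, defined through the graded Leibniz rule
   d_l (F G) = (d_l F) G + (-1)^(|l||F|) F (d_l G)
   and, on the field-independent parts, the Cauchy product in hbar. *)
Fixpoint fmul (R : realType) (F G : functional R) (w : seq (letter R))
    (n : nat) (xi : R) {struct w} : R[i] :=
  if w is l :: w' then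
    fmul (strip l F) G w' n xi + fmul (fgrade l F) (strip l G) w' n xi
  else \sum_(k < n.+1) F [::] k xi * G [::] (n - k)%N xi.

Definition fadd (R : realType) (F G : functional R) : functional R :=
  fun w n xi => F w n xi + G w n xi.

Definition fsum (R : realType) (k : nat) (F : 'I_k -> functional R) :
  functional R := fun w n xi => \sum_(i < k) F i w n xi.

Definition fval (R : realType) (a : fld) : functional R :=
  fun w n _ => if w is [:: Fld b _] then ((n == 0)%N && `[< b = a >])%:R else 0.

Definition chi (R : realType) : functional R :=
  fun w n _ => if w is [:: Chi] then (n == 0)%N%:R else 0.

(* d/dx^mu D(x): it brings down i p_mu from exp(i (ptot w).x). *)
Definition dpartial (R : realType) (mu : 'I_4) (D : functional R) :
  functional R :=
  fun w n xi => (0 +i* lower (ptot w) mu) * D w n xi.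

(* delta F / delta a(x): for a translation invariant F the momentum of the
   differentiated leg is fixed by momentum conservation. *)
Definition fderiv (R : realType) (a : fld) (F : functional R) : functional R :=
  fun w => F (Fld a (- ptot w) :: w).

(* The derivative with respect to the covariant component A_mu. *)
Definition fderivA (R : realType) (mu : 'I_4) (F : functional R) :
  functional R :=
  fun w n xi => \sum_(nu < 4) (eta R mu nu)%:C * fderiv (fA nu) F w n xi.

(* The integral of D(x) over x gives (2 pi)^4 delta(ptot w) D w. *)
Definition integ (R : realType) (D : functional R) : functional R :=
  fun w n xi => if ptot w == 0 then D w n xi else 0.

Definition dxi (R : realType) (F : functional R) : functional R :=
  fun w n xi => cderive (F w n) xi.

(* Derivative with respect to chi, taken after the derivatives listed in w. *)
Definition dchi (R : realType) (F : functional R) : functional R :=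
  fun w => F (rcons w Chi).

Definition graded_symmetric (R : realType) (F : functional R) : Prop :=
  forall (u v : seq (letter R)) (a b : letter R) n xi,
    F (u ++ a :: b :: v) n xi =
    (-1) ^+ (grass a && grass b) * F (u ++ b :: a :: v) n xi.

Definition translation_invariant (R : realType) (F : functional R) : Prop :=
  forall w n xi, ptot w != 0 -> F w n xi = 0.

(* Coefficients of the functional obtained from F by substituting
   A'^mu(x) = L^mu_nu A^nu(L^-1 x) and f'(x) = f(L^-1 x) for the others. *)
Fixpoint lorentz_act (R : realType) (L : 'M[R]_4) (F : functional R)
    (w : seq (letter R)) (n : nat) (xi : R) {struct w} : R[i] :=
  match w with
  | [::] => F [::] n xi
  | Fld (fA nu) p :: w' =>
      \sum_(mu < 4) (L mu nu)%:C
        * lorentz_act L (strip (Fld (fA mu) (L *m p)) F) w' n xi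
  | Fld a p :: w' => lorentz_act L (strip (Fld a (L *m p)) F) w' n xi
  | Chi :: w' => lorentz_act L (strip Chi F) w' n xi
  end.

Definition lorentz_invariant (R : realType) (F : functional R) : Prop :=
  forall L : 'M[R]_4, lorentz_group L ->
  forall w n xi, lorentz_act L F w n xi = F w n xi.

Definition C_invariant (R : realType) (F : functional R) : Prop :=
  forall w n xi, (-1) ^+ count (@Codd R) w * F w n xi = F w n xi.

Definition gh_neutral (R : realType) (F : functional R) : Prop :=
  forall w n xi, \sum_(l <- w) gh l != 0 -> F w n xi = 0.

(* mH is the Higgs mass: vf_higgs fixes the hbar^0 part of the Higgs 2-point
   function.  No regularity in the momenta is required, and the gauge parameter
   ranges over all of R. *)
Record vertex_functional (R : realType) (mH : R) (G : functional R) : Prop := {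
  vf_graded : graded_symmetric G;
  vf_translation : translation_invariant G;
  vf_lorentz : lorentz_invariant G;
  vf_C : C_invariant G;
  vf_gh : gh_neutral G;
  vf_xi : forall w n xi, cderivable (G w n) xi;
  vf_higgs : forall (p : mom R) xi,
    G [:: Fld phi1 p; Fld phi1 (- p)] 0%N xi = (mdot p p - mH ^+ 2)%:C }.

Definition slavnov_taylor (R : realType) (G : functional R) : functional R :=
  fadd
    (integ
      (fadd (fsum (fun mu : 'I_4 =>
               fmul (dpartial mu (fval fc)) (fderivA mu G)))
      (fadd (fmul (fval fB) (fderiv fcbar G))
            (fsum (fun i : 'I_2 =>
               fadd (fmul (fderiv (fY i) G) (fderiv (fphi i) G))
                    (fmul (fval (fq i)) (fderiv (fhphi i) G)))))))
    (fmul (@chi R) (dxi G)).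

(* T n xi s and L n xi s are the order hbar^n of the transversal and of the
   longitudinal part at p^2 = s.  The projectors are singular at p^2 = 0, so
   the values at s = 0 are left unconstrained. *)
Definition vector_decomposition (R : realType) (G : functional R)
    (T L : nat -> R -> R -> R[i]) : Prop :=
  forall n xi (p : mom R) (mu nu : 'I_4), mdot p p != 0 ->
    G [:: Fld (fA mu) p; Fld (fA nu) (- p)] n xi =
      (eta R mu nu - lower p mu * lower p nu / mdot p p)%:C * T n xi (mdot p p)
      + (lower p mu * lower p nu / mdot p p)%:C * L n xi (mdot p p).

Definition mass_condition (R : realType) (T : nat -> R -> R -> R[i])
    (m xi : R) : Prop :=
  forall n, T n xi (m ^+ 2) = 0.

(* dT/dp^2 = 1 as a power series in hbar. *)
Definition residue_condition (R : realType) (T : nat -> R -> R -> R[i])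
    (kappa2 xi : R) : Prop :=
  forall n, is_cderive (T n xi) kappa2 (n == 0)%N%:R.

(* Main.v *)
Require Import Defs.
From mathcomp Require Import all_boot all_order all_fingroup all_algebra.
From mathcomp Require Import all_classical all_reals all_analysis.
From mathcomp Require Import ring lra.

(* Differentiating the Slavnov-Taylor identity with respect to phi_1(0) and chi
   leaves, by ghost number, charge conjugation and Gamma_{phi_1} = 0, only
   Gamma_{Y_1 chi} Gamma_{phi_1 phi_1}(0) = 0; the second factor starts with
   - m_H^2, so the first one vanishes.  Differentiating it with respect to
   A^1(k), A^1(-k) and chi, where k has vanishing 1-component, leaves chi times
   d_xi Gamma_{A^1 A^1}(k) once one knows that the mixing Gamma_{phi_2 A^1}(k)
   vanishes, which follows from the rotation by pi in the (1,2)-plane.  Since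
   Gamma_{A^1 A^1}(k) = - Gamma^T(k^2), the transversal part is independent of
   xi.  The existence of the decomposition comes from Lorentz covariance: every
   momentum with p^2 <> 0 is moved by rotations and boosts in coordinate planes
   to a multiple of a basis vector, whose stabilizer fixes the tensor structure. *)

Import Order.TTheory GRing.Theory Num.Theory.
Import numFieldNormedType.Exports.
Local Open Scope ring_scope.

(** * Rotations and boosts in coordinate planes *)

Lemma ord4_ind (P : 'I_4 -> Prop) : P 0 -> P 1 -> P 2 -> P 3 -> forall i, P i.
Proof.
move=> P0 P1 P2 P3 [[|[|[|[|//]]]] lti].
- by rewrite (_ : Ordinal lti = 0) //; apply: val_inj.
- by rewrite (_ : Ordinal lti = 1) //; apply: val_inj.
- by rewrite (_ : Ordinal lti = 2) //; apply: val_inj.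
- by rewrite (_ : Ordinal lti = 3) //; apply: val_inj.
Qed.

Lemma sum_ord4 (V : nmodType) (F : 'I_4 -> V) :
  \sum_(i < 4) F i = F 0 + F 1 + F 2 + F 3.
Proof.
rewrite 4!big_ord_recl big_ord0 addr0 !addrA.
by congr (F _ + F _ + F _ + F _); apply: val_inj.
Qed.

(** One family for both kinds of plane transformation: [d = - s] gives rotations, [d = s] gives
    boosts. *)
Definition plane_mx {R : pzRingType} {n} (a b : 'I_n) (c s d : R) : 'M[R]_n :=
  \matrix_(i, j)
    (if i == a then c * (j == a)%:R + s * (j == b)%:R
     else if i == b then d * (j == a)%:R + c * (j == b)%:R
     else (j == i)%:R).

(** Multilinearity in rows [a] and [b] leaves four determinants with unit rows there: two have equal
    rows, one is the identity and one a transposition. *)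
Lemma det_plane_mx (R : comNzRingType) n (a b : 'I_n) (c s d : R) :
  a != b -> \det (plane_mx a b c s d) = c * c - s * d.
Proof.
move=> neq_ab.
have neq_ba : b != a by rewrite eq_sym.
pose N x y : 'M[R]_n :=
  \matrix_(i, j) (j == if i == a then x else if i == b then y else i)%:R.
pose P x : 'M[R]_n := \matrix_(i, j)
  (if i == a then (j == x)%:R
   else if i == b then d * (j == a)%:R + c * (j == b)%:R else (j == i)%:R).
have detP x : \det (P x) = d * \det (N x a) + c * \det (N x b).
  apply: (determinant_multilinear (i0 := b)); apply/matrixP => i j; rewrite !mxE.
  - by rewrite (negPf neq_ba) eqxx.
  - by rewrite ![lift _ _ == b]eq_sym (negPf (neq_lift _ _)); case: ifP.
  - by rewrite ![lift _ _ == b]eq_sym (negPf (neq_lift _ _)); case: ifP.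
have -> : \det (plane_mx a b c s d) = c * \det (P a) + s * \det (P b).
  apply: (determinant_multilinear (i0 := a)); apply/matrixP => i j; rewrite !mxE.
  - by rewrite eqxx.
  - by rewrite ![lift _ _ == a]eq_sym (negPf (neq_lift _ _)).
  - by rewrite ![lift _ _ == a]eq_sym (negPf (neq_lift _ _)).
have N0 x : \det (N x x) = 0.
  apply: (determinant_alternate neq_ab) => j.
  by rewrite !mxE eqxx (negPf neq_ba) eqxx.
have N1 : N a b = 1%:M.
  apply/matrixP => i j; rewrite !mxE eq_sym.
  by case: (altP (i =P a)) => [->//|_]; case: (altP (i =P b)) => [->|].
have Nt : N b a = perm_mx (tperm a b).
  apply/matrixP => i j; rewrite !mxE eq_sym.
  by rewrite permE /=.
by rewrite !detP !N0 N1 Nt det1 det_perm odd_tperm neq_ab expr1; ring.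
Qed.

(** Since [a < b], only [a] can be the time index; this decides between boost and rotation. The
    equation on [c], [s], [d] gives both the determinant and the preservation of [eta]. *)
Lemma lorentz_plane_mx (R : realType) (a b : 'I_4) (c s d : R) :
  (a < b)%N -> d = (if a == 0 then s else - s) -> c * c - s * d = 1 ->
  (a = 0 -> 0 < c) ->
  lorentz_group (plane_mx a b c s d).
Proof.
move=> lt_ab dE cs1 c_gt0; split; last 2 first.
- by rewrite det_plane_mx // neq_ltn lt_ab.
- rewrite mxE; move: a b lt_ab c_gt0 {dE cs1}.
  by apply: ord4_ind; apply: ord4_ind => //= _; rewrite ?mulr1 ?mulr0 ?addr0 => ->.
apply/matrixP => i j; rewrite !mxE sum_ord4 !mxE !sum_ord4 !mxE.
move: a b lt_ab dE cs1 c_gt0.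
apply: ord4_ind; apply: ord4_ind => //= _ dE cs1 _; rewrite dE in cs1 *.
all: move: i j; apply: ord4_ind; apply: ord4_ind => /=.
all: by first [ring | lra].
Qed.

Lemma plane_mxE (R : pzRingType) n (a b : 'I_n) (c s d : R) (p : 'cV[R]_n) i :
  a != b ->
  (plane_mx a b c s d *m p) i 0 =
    if i == a then c * p a 0 + s * p b 0
    else if i == b then d * p a 0 + c * p b 0 else p i 0.
Proof.
move=> neq_ab; rewrite mxE.
have sum1 k : \sum_j (j == k)%:R * p j 0 = p k 0.
  by rewrite (bigD1 k) //= eqxx mul1r big1 ?addr0 // => j /negPf ->; rewrite mul0r.
have sum2 x y : \sum_j (x * (j == a)%:R + y * (j == b)%:R) * p j 0 =
    x * p a 0 + y * p b 0.
  under eq_bigr do rewrite mulrDl -!mulrA.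
  by rewrite big_split /= -!mulr_sumr !sum1.
under eq_bigr do rewrite mxE.
by case: ifP => _; [|case: ifP => _]; rewrite ?sum2 ?sum1.
Qed.

Lemma mdotE (R : realType) (p : mom R) :
  mdot p p = p 0 0 ^+ 2 - p 1 0 ^+ 2 - p 2 0 ^+ 2 - p 3 0 ^+ 2.
Proof.
by rewrite /mdot /lower sum_ord4 !mxE !sum_ord4 !mxE /=; ring.
Qed.

Lemma lowerE (R : realType) (p : mom R) mu :
  lower p mu = (if mu == 0 then 1 else -1) * p mu 0.
Proof.
move: mu; apply: ord4_ind; rewrite /lower !mxE !sum_ord4 !mxE /=; ring.
Qed.

Lemma mdot_lorentz (R : realType) (L : 'M[R]_4) (p : mom R) :
  lorentz_group L -> mdot (L *m p) (L *m p) = mdot p p.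
Proof.
have mdotT (q : mom R) : mdot q q = (q^T *m (eta R *m q)) 0 0.
  by rewrite mxE; apply: eq_bigr => i _; rewrite [in RHS]mxE mulrC.
by case=> LL _ _; rewrite !mdotT trmx_mul -[in RHS]LL !mulmxA.
Qed.

(** * Lorentz orbits of momenta with nonzero square *)

Definition axis {R : pzRingType} {n} (a : 'I_n) (x : R) : 'cV[R]_n :=
  \col_i (if i == a then x else 0).

Lemma rotate_to_zero (R : rcfType) (x y : R) :
  exists c s : R, [/\ c * c + s * s = 1, c * x + s * y = 0 &
    c * y - s * x = Num.sqrt (x ^+ 2 + y ^+ 2)].
Proof.
set r := Num.sqrt _.
have r2 : r ^+ 2 = x ^+ 2 + y ^+ 2.
  by rewrite sqr_sqrtr // addr_ge0 ?sqr_ge0.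
have [r0|r_neq0] := eqVneq r 0.
  exists 1, 0; move/eqP: r2.
  rewrite r0 expr0n /= eq_sym paddr_eq0 ?sqr_ge0 // !sqrf_eq0.
  by case/andP => /eqP -> /eqP ->; split; ring.
exists (y / r), (- x / r); split.
- by apply: (mulIf (x := r ^+ 2)); rewrite ?sqrf_eq0 //; rewrite {2}r2; field.
- by field.
- apply: (mulIf (x := r)); rewrite // -[RHS]expr2 r2; field => //.
Qed.

(* Two rotations bring p to the (x^0, x^3)-plane, where a boost suffices. *)
Lemma lorentz_orbit (R : realType) (P : mom R -> Prop) (p : mom R) :
  (forall L q, lorentz_group L -> P (L *m q) -> P q) ->
  (0 < mdot p p -> P (axis 0 (Num.sqrt (mdot p p))) /\
    P (axis 0 (- Num.sqrt (mdot p p)))) ->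
  (mdot p p < 0 -> P (axis 3 (Num.sqrt (- mdot p p)))) ->
  mdot p p != 0 -> P p.
Proof.
move=> PL.
(* The rotation in the (1,2)-plane kills the 1-component; the one in the (2,3)-plane then kills the
   2-component and makes the 3-component nonnegative. *)
wlog [p1 p2 p3] : p / [/\ p 1 0 = 0, p 2 0 = 0 & 0 <= p 3 0].
  move=> red Pt Ps p_neq0.
  have [c [s [cs1 cs0 _]]] := rotate_to_zero _ (p 1 0) (p 2 0).
  have L1 : lorentz_group (plane_mx (1 : 'I_4) 2 c s (- s)).
    by apply: lorentz_plane_mx => //; rewrite mulrN opprK.
  apply: (PL _ _ L1); rewrite -!(mdot_lorentz _ _ p L1) in Pt Ps p_neq0.
  move: Pt Ps p_neq0; set q := _ *m p => Pt Ps q_neq0.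
  have q1 : q 1 0 = 0 by rewrite /q plane_mxE.
  have [c' [s' [cs1' cs0' cs3']]] := rotate_to_zero _ (q 2 0) (q 3 0).
  have L2 : lorentz_group (plane_mx (2 : 'I_4) 3 c' s' (- s')).
    by apply: lorentz_plane_mx => //; rewrite mulrN opprK.
  apply: (PL _ _ L2); rewrite -!(mdot_lorentz _ _ q L2) in Pt Ps q_neq0.
  apply: red => //; split; rewrite plane_mxE //=.
  by rewrite addrC mulNr cs3' sqrtr_ge0.
rewrite mdotE p1 p2 expr0n /= !subr0.
set x : R := p 0 0; set y : R := p 3 0 => Pt Ps.
have boost (c s : R) : c * c - s * s = 1 -> 0 < c ->
    lorentz_group (plane_mx (0 : 'I_4) 3 c s s).
  by move=> cs c_gt0; apply: lorentz_plane_mx.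
have axisP (q : 'cV[R]_4) a : (forall i, i != a -> q i 0 = 0) -> q = axis a (q a 0).
  move=> q0; apply/matrixP => i j; rewrite ord1 mxE.
  by case: (altP (i =P a)) => [->//|/q0].
rewrite neq_lt => /orP [lt0|gt0].
  set k := Num.sqrt _ in Ps.
  have k2 : k ^+ 2 = y ^+ 2 - x ^+ 2 by rewrite sqr_sqrtr; lra.
  have k_gt0 : 0 < k by rewrite sqrtr_gt0; lra.
  have k_neq0 : k != 0 by rewrite gt_eqF.
  have y_gt0 : 0 < y.
    rewrite lt_neqAle p3 andbT eq_sym; apply/eqP => y0.
    by move: lt0; rewrite y0; nra.
  (* Boost to zero energy; its coefficient [y / k] is positive because [y] is. *)
  apply: (PL _ _ (boost (y / k) (- x / k) _ _)).
  - by apply: (mulIf (x := k ^+ 2)); rewrite ?sqrf_eq0 // mul1r [RHS]k2; field.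
  - by rewrite divr_gt0.
  rewrite (axisP (plane_mx _ _ _ _ _ *m p) 3); last first.
    apply: ord4_ind => //= _; rewrite plane_mxE //= -/x -/y; field => //.
  rewrite plane_mxE //= -/x -/y (_ : _ + _ = k); first exact: Ps.
  by apply: (mulIf (x := k)); rewrite // -[RHS]expr2 k2; field.
set k := Num.sqrt _ in Pt.
have k2 : k ^+ 2 = x ^+ 2 - y ^+ 2 by rewrite sqr_sqrtr; lra.
have k_gt0 : 0 < k by rewrite sqrtr_gt0; lra.
have k_neq0 : k != 0 by rewrite gt_eqF.
have x_neq0 : x != 0 by apply/eqP => x0; move: gt0; rewrite x0; nra.
(* The sign of the energy, which an orthochronous boost preserves; it selects one of the two
   time-axis hypotheses. *)
pose e : R := if 0 < x then 1 else -1.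
have ee : e * e = 1 by rewrite /e; case: ifP => _; ring.
have ex_gt0 : 0 < e * x.
  rewrite /e; case: ifPn => [x_gt0|]; first by rewrite mul1r.
  by rewrite -leNgt mulN1r oppr_gt0 lt_neqAle x_neq0.
apply: (PL _ _ (boost (e * x / k) (- (e * y) / k) _ _)).
- apply: (mulIf (x := k ^+ 2)); rewrite ?sqrf_eq0 // mul1r [RHS]k2.
  rewrite -[RHS]mul1r -ee; field => //.
- by rewrite divr_gt0.
rewrite (axisP (plane_mx _ _ _ _ _ *m p) 0); last first.
  apply: ord4_ind => //= _; rewrite plane_mxE //= -/x -/y; field => //.
rewrite plane_mxE //= -/x -/y (_ : _ + _ = e * k).
  by rewrite /e; case: ifP => _; rewrite ?mul1r ?mulN1r; have [] := Pt gt0.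
by apply: (mulIf (x := k)); rewrite // -[RHS]mulrA -expr2 k2; field.
Qed.

(** * Tensors invariant under the stabilizer of an axis *)

Lemma sum_plane_mx (R : realType) n (a b : 'I_n) (c s d : R)
    (F : 'I_n -> R[i]%C) j :
  a != b ->
  \sum_i (plane_mx a b c s d i j)%:C%C * F i =
    if j == a then c%:C%C * F a + d%:C%C * F b
    else if j == b then s%:C%C * F a + c%:C%C * F b else F j.
Proof.
move=> neq_ab; have neq_ba : b != a by rewrite eq_sym.
rewrite (bigD1 a) //= (bigD1 b) //= !mxE !eqxx (negPf neq_ba).
have -> : \sum_(i < n | (i != a) && (i != b)) (plane_mx a b c s d i j)%:C%C * F i =
    if (j == a) || (j == b) then 0 else F j.
  case: ifPn => [jab|]; last first.
    rewrite negb_or => jab; rewrite (bigD1 j) //= big1.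
      by rewrite mxE (negPf (proj1 (andP jab))) (negPf (proj2 (andP jab)))
        eqxx mul1r addr0.
    move=> i /andP [/andP [ia ib] ij].
    by rewrite mxE (negPf ia) (negPf ib) eq_sym (negPf ij) mul0r.
  apply: big1 => i /andP [ia ib]; rewrite mxE (negPf ia) (negPf ib).
  case: (altP (j =P i)) => [ji|_]; last by rewrite mul0r.
  by move: jab; rewrite ji (negPf ia) (negPf ib).
case: (altP (j =P a)) => [->|ja] /=.
  by rewrite (negPf neq_ab) !mulr1 !mulr0 !addr0.
by case: ifP => _; rewrite !(mulr1, mulr0, add0r, addr0, mul0r).
Qed.

(** This is [L^T M L = M], with the sums nested as in the unfolding of [lorentz_act] on two vector
    legs. *)
Definition tensor_invariant {R : realType} {n} (L : 'M[R]_n)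
    (M : 'I_n -> 'I_n -> R[i]%C) : Prop :=
  forall mu nu, M mu nu =
    \sum_a (L a mu)%:C%C * (\sum_b (L b nu)%:C%C * M a b).

Lemma eq_scale_eq0 (R : realType) (c : R) (x : R[i]%C) :
  c != 1 -> x = c%:C%C * x -> x = 0.
Proof.
move=> c_neq1 /eqP; rewrite -subr_eq0 -{1}[x]mul1r -mulrBl mulf_eq0.
case/orP => [|/eqP //].
by rewrite -[1](rmorph1 (real_complex R)) -rmorphB fmorph_eq0 subr_eq0 eq_sym
  (negPf c_neq1).
Qed.

(** The half turn reverses the directions [a] and [b], so a component with exactly one index among
    them equals its own negative. *)
Lemma tensor_invariant_flip (R : realType) n (a b : 'I_n)
    (M : 'I_n -> 'I_n -> R[i]%C) :
  a != b -> tensor_invariant (plane_mx a b (-1) 0 0) M ->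
  forall mu nu, (mu == a) || (mu == b) -> ~~ ((nu == a) || (nu == b)) ->
  M mu nu = 0 /\ M nu mu = 0.
Proof.
move=> neq_ab Minv mu nu mu_ab; rewrite negb_or => /andP [/negPf na /negPf nb].
have neq_ba : b != a by rewrite eq_sym.
have N1 : -1 != 1 :> R by rewrite eqNr oner_neq0.
split; apply: (eq_scale_eq0 _ _ _ N1); rewrite {1}Minv !sum_plane_mx // na nb.
  case: (altP (mu =P a)) mu_ab => [-> _|_ /= /eqP ->].
    by rewrite mul0r addr0.
  by rewrite eqxx mul0r add0r.
case: (altP (mu =P a)) mu_ab => [-> _|_ /= /eqP ->].
  by rewrite mul0r addr0.
by rewrite eqxx mul0r add0r.
Qed.

(** The quarter turn exchanges the two directions up to a sign, which enters squared. *)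
Lemma tensor_invariant_quarter (R : realType) n (a b : 'I_n)
    (M : 'I_n -> 'I_n -> R[i]%C) :
  a != b -> tensor_invariant (plane_mx a b 0 1 (-1)) M -> M a a = M b b.
Proof.
move=> neq_ab Minv; rewrite {1}Minv !sum_plane_mx // eqxx.
by rewrite !mul0r !add0r rmorphN1 mulrA mulrNN !mul1r.
Qed.

(** Spatial rotations fix the time axis: half turns kill all off-diagonal components, quarter turns
    equate the three spatial diagonal ones. *)
Lemma timelike_tensor (R : realType) (M : 'I_4 -> 'I_4 -> R[i]%C) (x : R) :
  (forall L, lorentz_group L -> L *m axis (0 : 'I_4) x = axis 0 x ->
    tensor_invariant L M) ->
  forall mu nu, M mu nu = (eta R mu nu)%:C%C * - M 1 1 +
    (if (mu == 0) && (nu == 0) then 1 else 0) * (M 0 0 + M 1 1).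
Proof.
move=> Minv.
have rot (a b : 'I_4) (c s : R) : a != 0 -> (a < b)%N -> c * c + s * s = 1 ->
    tensor_invariant (plane_mx a b c s (- s)) M.
  move=> a0 lt_ab cs; have neq_ab : a != b by rewrite neq_ltn lt_ab.
  have b0 : b != 0 by apply: contraTneq lt_ab => ->.
  apply: Minv; first apply: lorentz_plane_mx => //.
  - by rewrite (negPf a0).
  - by rewrite mulrN opprK.
  - by move=> a00; rewrite a00 eqxx in a0.
  apply/matrixP => i j; rewrite ord1 plane_mxE // !mxE (negPf a0) (negPf b0).
  rewrite !mulr0 !addr0.
  case: (altP (i =P a)) => [->|_]; first by rewrite (negPf a0).
  by case: (altP (i =P b)) => [->|_] //; rewrite (negPf b0).
have flip (a b : 'I_4) : a != 0 -> (a < b)%N ->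
    forall mu nu, (mu == a) || (mu == b) -> ~~ ((nu == a) || (nu == b)) ->
    M mu nu = 0 /\ M nu mu = 0.
  move=> a0 lt_ab; apply: tensor_invariant_flip; first by rewrite neq_ltn lt_ab.
  by rewrite -[X in plane_mx _ _ _ _ X]oppr0; apply: rot => //;
    rewrite mulr0 addr0 mulrNN mulr1.
have quarter (a b : 'I_4) : a != 0 -> (a < b)%N -> M a a = M b b.
  move=> a0 lt_ab; apply: tensor_invariant_quarter; first by rewrite neq_ltn lt_ab.
  by apply: rot => //; rewrite mulr0 add0r mulr1.
have [M10 M01] := flip 1 2 isT isT 1 0 isT isT.
have [M20 M02] := flip 1 2 isT isT 2 0 isT isT.
have [M13 M31] := flip 1 2 isT isT 1 3 isT isT.
have [M23 M32] := flip 1 2 isT isT 2 3 isT isT.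
have [M30 M03] := flip 2 3 isT isT 3 0 isT isT.
have [M21 M12] := flip 2 3 isT isT 2 1 isT isT.
have M11 := quarter 1 2 isT isT.
have M22 := quarter 2 3 isT isT.
apply: ord4_ind; apply: ord4_ind => /=; rewrite mxE /=
  ?(M01, M02, M03, M10, M12, M13, M20, M21, M23, M30, M31, M32) -?M22 -?M11
  ?rmorphN1 ?rmorph1 ?rmorph0; ring.
Qed.

(** The 3-axis is fixed by rotations in the (1,2)-plane and by boosts in the (0,1)-plane. The half
    turn separates the indices 1, 2 from 0, 3; the boost removes the remaining mixed components and
    ties [M 0 0] to [M 1 1]. *)
Lemma spacelike_tensor (R : realType) (M : 'I_4 -> 'I_4 -> R[i]%C) (x : R) :
  (forall L, lorentz_group L -> L *m axis (3 : 'I_4) x = axis 3 x ->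
    tensor_invariant L M) ->
  forall mu nu, M mu nu = (eta R mu nu)%:C%C * - M 1 1 +
    (if (mu == 3) && (nu == 3) then 1 else 0) * (M 3 3 - M 1 1).
Proof.
move=> Minv.
have fix3 (a b : 'I_4) (c s d : R) : (a < b)%N -> (b < 3)%N ->
    plane_mx a b c s d *m axis 3 x = axis 3 x.
  move=> lt_ab b3; have neq_ab : a != b by rewrite neq_ltn lt_ab.
  have /negPf bn3 : b != 3 by apply: contraTneq b3 => ->.
  have /negPf an3 : a != 3 by apply: contraTneq (ltn_trans lt_ab b3) => ->.
  apply/matrixP => i j; rewrite ord1 plane_mxE // !mxE an3 bn3 !mulr0 !addr0.
  case: (altP (i =P a)) => [->|_]; first by rewrite an3.
  by case: (altP (i =P b)) => [->|_] //; rewrite bn3.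
have rot (c s : R) : c * c + s * s = 1 ->
    tensor_invariant (plane_mx (1 : 'I_4) 2 c s (- s)) M.
  move=> cs; apply: Minv; last exact: fix3.
  by apply: lorentz_plane_mx => //; rewrite mulrN opprK.
have flip mu nu : (mu == 1) || (mu == 2) -> ~~ ((nu == 1) || (nu == 2)) ->
    M mu nu = 0 /\ M nu mu = 0.
  apply: tensor_invariant_flip => //.
  by rewrite -[X in plane_mx _ _ _ _ X]oppr0; apply: rot => //;
    rewrite mulr0 addr0 mulrNN mulr1.
have M11 : M 1 1 = M 2 2.
  by apply: tensor_invariant_quarter => //; apply: rot; rewrite mulr0 add0r mulr1.
have [M10 M01] := flip 1 0 isT isT.
have [M20 M02] := flip 2 0 isT isT.
have [M13 M31] := flip 1 3 isT isT.
have [M23 M32] := flip 2 3 isT isT.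
(* A rational boost from the triple 3, 4, 5. As [c != 1], a component that the boost merely
   multiplies by [c] vanishes. *)
pose c : R := 5 / 4; pose s : R := 3 / 4.
have boost : tensor_invariant (plane_mx (0 : 'I_4) 1 c s s) M.
  apply: Minv; last exact: fix3.
  by apply: lorentz_plane_mx => //; rewrite /c /s; [field | lra].
have c1 : c != 1 by apply/eqP; rewrite /c; lra.
have M03 : M 0 3 = 0.
  apply: (eq_scale_eq0 _ _ _ c1); rewrite {1}boost !sum_plane_mx //=.
  by rewrite M13 mulr0 addr0.
have M30 : M 3 0 = 0.
  apply: (eq_scale_eq0 _ _ _ c1); rewrite {1}boost !sum_plane_mx //=.
  by rewrite M31 mulr0 addr0.
have M12 : M 1 2 = 0.
  apply: (eq_scale_eq0 _ _ _ c1); rewrite {1}boost !sum_plane_mx //=.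
  by rewrite M02 mulr0 add0r.
have M21 : M 2 1 = 0.
  apply: (eq_scale_eq0 _ _ _ c1); rewrite {1}boost !sum_plane_mx //=.
  by rewrite M20 mulr0 add0r.
(* The boost gives [M 0 0 = c^2 M 0 0 + s^2 M 1 1] with [s^2 = c^2 - 1], so [M 0 0 + M 1 1] is [c^2]
   times itself. *)
have M00 : M 0 0 = - M 1 1.
  have := boost 0 0; rewrite !sum_plane_mx //= M01 M10 !mulr0 addr0 add0r.
  rewrite !mulrA -!rmorphM => M00; apply/eqP; rewrite -addr_eq0; apply/eqP.
  apply: (eq_scale_eq0 _ (c * c)); first by apply/eqP; rewrite /c; lra.
  rewrite {1}M00 (_ : s * s = c * c - 1); last by rewrite /c /s; field.
  by rewrite rmorphB rmorph1; ring.
apply: ord4_ind; apply: ord4_ind => /=; rewrite mxE /=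
  ?(M01, M02, M03, M10, M12, M13, M20, M21, M23, M30, M31, M32, M00) -?M11
  ?rmorphN1 ?rmorph1 ?rmorph0; ring.
Qed.

(** * Tensor form of the vector 2-point function *)

Lemma lower_axis (R : realType) (a : 'I_4) (x : R) mu :
  lower (axis a x) mu = (if mu == a then eta R a a * x else 0).
Proof.
rewrite lowerE !mxE eqxx; case: (altP (mu =P a)) => [->//|_].
by rewrite mulr0.
Qed.

Lemma axisN (R : realType) (a : 'I_4) (x : R) : axis a (- x) = - axis a x.
Proof. by apply/matrixP => i j; rewrite !mxE; case: ifP; rewrite ?oppr0. Qed.

(** Turns the single-entry tensor of the two stabilizer lemmas into [p_mu p_nu / x^2]; the metric
    sign enters squared. *)
Lemma lower_axisM (R : realType) (a : 'I_4) (x : R) (y : R[i]%C) mu nu : x != 0 ->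
  (lower (axis a x) mu * lower (axis a x) nu)%:C%C * (y * (x ^- 2)%:C%C) =
  (if (mu == a) && (nu == a) then 1 else 0) * y.
Proof.
move=> x_neq0; rewrite !lower_axis.
case: (mu == a); rewrite ?mul0r ?rmorph0 ?mul0r //.
case: (nu == a); rewrite /= ?mulr0 ?rmorph0 ?mul0r //.
have eta_x2 : eta R a a * x * (eta R a a * x) * x ^- 2 = 1.
  by rewrite mxE eqxx; case: ifP => _; field.
by rewrite [y * _]mulrC [LHS]mulrA -rmorphM eta_x2 rmorph1.
Qed.

(** A reference momentum of square [s]. Its 1-component vanishes in both cases, so index 1 is always
    a transversal direction. *)
Definition shell {R : realType} (s : R) : mom R :=
  if 0 < s then axis 0 (Num.sqrt s) else axis 3 (Num.sqrt (- s)).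

Lemma mdot_shell (R : realType) (s : R) : mdot (shell s) (shell s) = s.
Proof.
rewrite mdotE /shell; case: ltP => s0; rewrite !mxE /= expr0n /= ?subr0 ?sub0r.
  by rewrite sqr_sqrtr // ltW.
by rewrite sqr_sqrtr ?opprK // oppr_ge0.
Qed.

Section VectorTwoPoint.
Variables (R : realType) (G : functional R).
Hypothesis G_lorentz : lorentz_invariant G.
Variables (n : nat) (xi : R).

Definition vector_2pt (p : mom R) (mu nu : 'I_4) : R[i]%C :=
  G [:: Fld (fA mu) p; Fld (fA nu) (- p)] n xi.

Lemma vector_2pt_lorentz L p mu nu : lorentz_group L ->
  vector_2pt p mu nu =
    \sum_a (L a mu)%:C%C * (\sum_b (L b nu)%:C%C * vector_2pt (L *m p) a b).
Proof.
move=> HL; rewrite /vector_2pt -(G_lorentz _ HL) /=.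
by apply: eq_bigr => a _; congr (_ * _); apply: eq_bigr => b _; rewrite mulmxN.
Qed.

Definition tensor_form (a b : R[i]%C) (p : mom R) : Prop :=
  forall mu nu, vector_2pt p mu nu =
    (eta R mu nu)%:C%C * a + (lower p mu * lower p nu)%:C%C * b.

(** Both structures are covariant with unchanged coefficients: [L^T eta L = eta] also yields the
    transformation law of the lowered momentum. *)
Lemma tensor_form_lorentz a b L p : lorentz_group L ->
  tensor_form a b (L *m p) -> tensor_form a b p.
Proof.
move=> HL form mu nu; have [LL _ _] := HL.
rewrite (vector_2pt_lorentz L) //.
have lowerL k : lower p k = \sum_i L i k * lower (L *m p) i.
  rewrite /lower -[in LHS]LL -!mulmxA mxE.
  by apply: eq_bigr => i _; rewrite [in LHS]mxE.
have etaL : eta R mu nu = \sum_i L i mu * (\sum_j L j nu * eta R i j).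
  rewrite -[in LHS]LL -mulmxA mxE; apply: eq_bigr => i _.
  rewrite mxE [in LHS]mxE; congr (_ * _); apply: eq_bigr => j _; exact: mulrC.
rewrite etaL !lowerL !sum_ord4 !form !(rmorphD, rmorphM); ring.
Qed.

Lemma vector_2pt_flip p mu nu : graded_symmetric G ->
  vector_2pt (- p) mu nu = vector_2pt p nu mu.
Proof.
move=> G_sym; rewrite /vector_2pt opprK.
by rewrite (G_sym [::] [::]) /= expr0 mul1r.
Qed.

Lemma tensor_form_timelike (x : R) : x != 0 ->
  tensor_form (- vector_2pt (axis 0 x) 1 1)
    ((vector_2pt (axis 0 x) 0 0 + vector_2pt (axis 0 x) 1 1) * (x ^- 2)%:C%C)
    (axis 0 x).
Proof.
move=> x_neq0 mu nu; rewrite lower_axisM //; apply: (timelike_tensor _ _ x) => L HL Lx.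
by move=> mu' nu'; rewrite (vector_2pt_lorentz L) // Lx.
Qed.

Lemma tensor_form_spacelike (x : R) : x != 0 ->
  tensor_form (- vector_2pt (axis 3 x) 1 1)
    ((vector_2pt (axis 3 x) 3 3 - vector_2pt (axis 3 x) 1 1) * (x ^- 2)%:C%C)
    (axis 3 x).
Proof.
move=> x_neq0 mu nu; rewrite lower_axisM //; apply: (spacelike_tensor _ _ x) => L HL Lx.
by move=> mu' nu'; rewrite (vector_2pt_lorentz L) // Lx.
Qed.

(* The graded symmetry relates the forward and the backward cone, which no
   proper orthochronous transformation exchanges. *)
Lemma vector_2pt_form (s : R) : graded_symmetric G -> s != 0 ->
  exists b, forall p, mdot p p = s ->
    tensor_form (- vector_2pt (shell s) 1 1) b p.
Proof.
move=> G_sym s_neq0.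
pose P b q := tensor_form (- vector_2pt (shell s) 1 1) b q.
case: (ltrP 0 s) => [s_gt0|s_le0].
  have sq_neq0 : Num.sqrt s != 0 by rewrite gt_eqF // sqrtr_gt0.
  have := tensor_form_timelike _ sq_neq0.
  set b := (X in tensor_form _ X); move=> form; exists b => p ps.
  apply: (lorentz_orbit _ (P b)); rewrite ?ps //.
  - by move=> L q HL; apply: tensor_form_lorentz.
  - rewrite /P /shell s_gt0 => _; split=> //.
    (* Exchanging the bosonic legs reverses the momentum and transposes the indices; the form is
       even in the momentum and symmetric in the indices. *)
    rewrite axisN => mu nu; rewrite vector_2pt_flip // form.
    by rewrite -[in RHS]axisN !lower_axis; congr (_ * _ + _%:C%C * _);
      [rewrite !mxE eq_sym; case: (altP (mu =P nu)) => [->//|_] |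
       do 2 case: ifP => _; ring].
  - by rewrite ltNge ltW.
have s_lt0 : s < 0 by rewrite lt_neqAle s_neq0.
have sq_neq0 : Num.sqrt (- s) != 0 by rewrite gt_eqF // sqrtr_gt0 oppr_gt0.
have := tensor_form_spacelike _ sq_neq0.
set b := (X in tensor_form _ X); move=> form; exists b => p ps.
apply: (lorentz_orbit _ (P b)); rewrite ?ps //.
- by move=> L q HL; apply: tensor_form_lorentz.
- by rewrite ltNge s_le0.
- by rewrite /P /shell => _; rewrite ltNge s_le0.
Qed.

End VectorTwoPoint.

Lemma vector_decomposition_exists (R : realType) (G : functional R) :
  lorentz_invariant G -> graded_symmetric G ->
  exists T L, vector_decomposition G T L.
Proof.
move=> G_lor G_sym.
pose T n xi s := - vector_2pt _ G n xi (shell s) 1 1.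
(* The coefficient must be a function of order, [xi] and [p^2] alone; at [p^2 = 0] it is an
   arbitrary default. *)
have /choice [b bP] (t : nat * R * R) : exists b, forall p,
    t.2 != 0 -> mdot p p = t.2 -> tensor_form _ G t.1.1 t.1.2 (T t.1.1 t.1.2 t.2) b p.
  case: t => [[n xi] s] /=; have [->|s_neq0] := eqVneq s 0.
    by exists 0.
  have [b bP] := vector_2pt_form _ _ G_lor n xi _ G_sym s_neq0.
  by exists b => p _; apply: bP.
(* With [s = p^2], [eta T + p p b] equals [(eta - p p / s) T + (p p / s) (T + s b)], which gives the
   longitudinal part. *)
exists T, (fun n xi s => T n xi s + s%:C%C * b (n, xi, s)) => n xi p mu nu p_neq0.
have /= := bP (n, xi, mdot p p) p p_neq0 erefl mu nu; rewrite /vector_2pt => ->.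
rewrite [in RHS]rmorphB mulrBl mulrDr addrA subrK mulrA -rmorphM.
by rewrite divfK.
Qed.

Lemma transversal_shell (R : realType) (G : functional R) T L n xi (s : R) :
  vector_decomposition G T L -> s != 0 ->
  T n xi s = - G [:: Fld (fA 1) (shell s); Fld (fA 1) (- shell s)] n xi.
Proof.
move=> dec s_neq0; have := dec n xi (shell s) 1 1; rewrite mdot_shell => ->//.
have -> : lower (shell s) 1 = 0.
  by rewrite /shell; case: ifP => _; rewrite lower_axis.
by rewrite !mul0r addr0 subr0 mxE /= rmorphN1 mulN1r opprK.
Qed.

(* The rotation by pi in the (1,2)-plane fixes the momentum and reverses A^1. *)
Lemma transverse_mixing_eq0 (R : realType) (G : functional R) i s n xi :
  lorentz_invariant G ->
  G [:: Fld (fphi i) (- shell s); Fld (fA 1) (shell s)] n xi = 0 /\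
  G [:: Fld (fphi i) (shell s); Fld (fA 1) (- shell s)] n xi = 0.
Proof.
move=> G_lor.
pose L : 'M[R]_4 := plane_mx 1 2 (-1) 0 0.
have HL : lorentz_group L.
  by apply: lorentz_plane_mx; rewrite //= ?oppr0 // mulr0 subr0 mulrNN mulr1.
have Lk : L *m shell s = shell s.
  apply/matrixP => k j; rewrite ord1 plane_mxE // /shell.
  by case: (0 < s); rewrite !mxE /= !mulr0 addr0; move: k; apply: ord4_ind.
have kill p q : L *m p = p -> L *m q = q ->
    G [:: Fld (fphi i) p; Fld (fA 1) q] n xi = 0.
  move=> Lp Lq; apply: (eq_scale_eq0 _ (-1 : R)); first by rewrite eqNr oner_neq0.
  rewrite -{1}(G_lor _ HL) /= Lp Lq sum_plane_mx //=.
  by rewrite rmorph0 mul0r addr0.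
by split; apply: kill; rewrite ?mulmxN ?Lk.
Qed.

(** * Graded products and the terms of the Slavnov-Taylor identity *)

(** The Leibniz rule expands the product, up to signs, over all distributions of the letters: the
    mask [m] selects those that act on [F], the others act on [H]. *)
Lemma fmul_eq0 (R : realType) (F H : functional R) w :
  (forall m : bitseq, size m = size w ->
    (forall n xi, F (mask m w) n xi = 0) \/
    (forall n xi, H (mask (map negb m) w) n xi = 0)) ->
  forall n xi, fmul F H w n xi = 0.
Proof.
elim: w F H => [|l w IH] F H FH n xi /=.
  by case: (FH [::] erefl) => z0; apply: big1 => k _; rewrite z0 ?mul0r ?mulr0.
rewrite !IH ?addr0 // => m sz_m.
  have [z0|z0] := FH (false :: m) (congr1 S sz_m); [left|by right].
  by move=> n' xi'; rewrite /fgrade z0 mulr0.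
have [z0|z0] := FH (true :: m) (congr1 S sz_m); [by left|by right].
Qed.

(** The elementary field [a] only responds to a single letter [a]. The factor [D] also covers
    derivatives of that field, such as [dpartial mu (fval fc)]. *)
Lemma fmul_fval_eq0 (R : realType) (a : fld) (D H : functional R) w :
  (forall u n xi, fval a u n xi = 0 -> D u n xi = 0) ->
  all (fun l : letter R => if l is Fld b _ then ~~ `[< b = a >] else true) w ->
  forall n xi, fmul D H w n xi = 0.
Proof.
move=> D0 all_w; apply: fmul_eq0 => m _; left => n xi; apply: D0.
have := all_mask m all_w.
case: (mask m w) => [|[b p|] [|]] //= /andP [/negPf -> _].
by rewrite andbF.
Qed.

(** The terms with an explicit [c], [B] or [q_i] need a matching letter, and words in [A], [phi] and
    [Chi] offer none. *)
Lemma slavnov_taylor_no_source (R : realType) (G : functional R) w n xi :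
  ptot w = 0 ->
  all (fun l : letter R => if l is Fld b _ then
         if b is (fA _ | fphi _) then true else false else true) w ->
  slavnov_taylor G w n xi =
  fmul (fderiv Y1 G) (fderiv phi1 G) w n xi +
  fmul (fderiv (fY 1) G) (fderiv (fphi 1) G) w n xi +
  fmul (@chi R) (dxi G) w n xi.
Proof.
move=> w0 all_w; rewrite /slavnov_taylor /fadd /integ w0 eqxx /fsum.
have no a : (if a is (fA _ | fphi _) then false else true) ->
    all (fun l : letter R => if l is Fld b _ then ~~ `[< b = a >] else true) w.
  move=> a_src; apply: sub_all all_w => -[b p|] //= b_ok.
  by apply/asboolPn => ba; move: a_src b_ok; rewrite ba; case: a {ba}.
rewrite big1 ?add0r => [|mu _]; last first.
  apply: (fmul_fval_eq0 R fc); last exact: no.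
  by move=> u n' xi' u0; rewrite /dpartial u0 mulr0.
rewrite (fmul_fval_eq0 R fB (fval fB)) ?add0r; [|by []|exact: no].
have q0 i : fmul (fval (fq i)) (fderiv (fhphi i) G) w n xi = 0.
  by apply: (fmul_fval_eq0 R (fq i)) => //; apply: no.
congr (_ + _); rewrite big_ord_recl big_ord1 !q0 !addr0.
by congr (_ + fmul (fderiv (fY _) G) (fderiv (fphi _) G) w n xi); apply: val_inj.
Qed.

(** A formal power series with nonzero constant term is not a zero divisor: by induction order [n]
    reduces to [a n * b 0 = 0]. *)
Lemma cauchy_product_eq0 (K : idomainType) (a b : nat -> K) :
  b 0%N != 0 -> (forall n, \sum_(k < n.+1) a k * b (n - k)%N = 0) ->
  forall n, a n = 0.
Proof.
move=> b0 ab n; elim/ltn_ind: n => n IH.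
have := ab n; rewrite big_ord_recr /= big1 ?add0r => [|k _]; last first.
  by rewrite IH ?mul0r.
by rewrite subnn => /eqP; rewrite mulf_eq0 (negPf b0) orbF => /eqP.
Qed.

Lemma cderive0 (R : realType) (xi : R) : cderive (fun _ : R => 0 : R[i]%C) xi = 0.
Proof. by rewrite /cderive /= derive1_cst. Qed.

Lemma ptot_phi1_chi (R : realType) : ptot [:: Fld phi1 (0 : mom R); Chi] = 0.
Proof. by rewrite /ptot !big_cons big_nil /= !addr0. Qed.

Lemma fmul_chi_even (R : realType) (F : functional R) a p b q n xi :
  ~~ fld_odd a -> ~~ fld_odd b ->
  fmul (@chi R) F [:: Fld a p; Fld b q; Chi] n xi = F [:: Fld a p; Fld b q] n xi.
Proof.
move=> /negPf ea /negPf eb.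
rewrite /= /fgrade /strip /chi /= ea eb /=.
(* Of the eight distributions only the seventh survives: both fields on [F], [Chi] on [chi]. Moving
   [chi] past even letters costs no sign. *)
do 6 (rewrite big1 ?add0r => [|k _]; last by rewrite ?mulr0 mul0r).
rewrite [X in _ + X]big1 ?addr0 => [|k _]; last by rewrite !mulr0 mul0r.
rewrite big_ord_recl big1 ?addr0 => [|k _]; last by rewrite !mulr0 mul0r.
by rewrite !mul1r subn0.
Qed.

(** * Consequences of the Slavnov-Taylor identity *)

Section VertexFunctional.
Variables (R : realType) (mH : R) (G : functional R).
Hypothesis G_vertex : vertex_functional mH G.

Lemma Codd_eq0 w n xi : odd (count (@Codd R) w) -> G w n xi = 0.
Proof.
move=> w_odd; have := vf_C G_vertex w n xi.
rewrite -signr_odd w_odd expr1 mulN1r => /eqP; rewrite eqNr => /eqP //.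
Qed.

Lemma gh_eq0 w n xi : \sum_(l <- w) gh l != 0 -> G w n xi = 0.
Proof. exact: (vf_gh G_vertex). Qed.

Hypothesis G_ST : forall w n xi, slavnov_taylor G w n xi = 0.
Hypothesis G_phi1 : forall n xi, G [:: Fld phi1 0] n xi = 0.

Lemma dxi_phi1 n xi : dxi G [:: Fld phi1 0] n xi = 0.
Proof.
rewrite /dxi (_ : G _ n = fun=> 0) ?cderive0 //.
by apply/funext => t; apply: G_phi1.
Qed.

Lemma Y1_chi_eq0 (mH_neq0 : mH != 0) n xi : G [:: Fld Y1 0; Chi] n xi = 0.
Proof.
pose w : seq (letter R) := [:: Fld phi1 0; Chi].
apply: (cauchy_product_eq0 _ (fun k => G [:: Fld Y1 0; Chi] k xi)
  (fun k => G [:: Fld phi1 0; Fld phi1 0] k xi)).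
  have := vf_higgs G_vertex 0 xi; rewrite oppr0 => ->; rewrite mdotE !mxE /=.
  rewrite !expr0n /= !subr0 sub0r.
  by rewrite fmorph_eq0 oppr_eq0 sqrf_eq0.
move=> {}n; have := G_ST w n xi.
rewrite slavnov_taylor_no_source ?ptot_phi1_chi //.
(* In the product with index 2, the [Y_2] factor is C-odd when it carries [Chi] and has ghost number
   -1 otherwise. *)
rewrite [X in _ + X + _](fmul_eq0 R _ _ w) ?addr0; last first.
  move=> [|[] [|[] []]] //= _; left => n' xi'; rewrite /fderiv.
  - by apply: Codd_eq0.
  - by apply: gh_eq0; rewrite !big_cons big_nil.
  - by apply: Codd_eq0.
  - by apply: gh_eq0; rewrite !big_cons big_nil.
(* The factor [chi] must absorb exactly [Chi], leaving the [xi]-derivative of the vanishing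
   tadpole. *)
rewrite [X in _ + X](fmul_eq0 R _ _ w) ?addr0; last first.
  move=> [|[] [|[] []]] //= _; try by left.
  by right => n' xi'; apply: dxi_phi1.
rewrite /= /fgrade /strip /fderiv /= /ptot !big_cons !big_nil /= !addr0 oppr0.
(* Of the four splits for index 1, the first contains the tadpole, and the second and fourth have a
   [Y_1] factor of ghost number -1. The third is the Cauchy product wanted. *)
rewrite big1 ?add0r => [|k _]; last by rewrite G_phi1 mulr0.
rewrite big1 ?add0r => [|k _]; last first.
  by rewrite (gh_eq0 [:: Fld Y1 0; _]) ?mulr0 ?mul0r // !big_cons big_nil.
rewrite [X in _ + X]big1 ?addr0 => [S0|k _]; last first.
  by rewrite (gh_eq0 [:: Fld Y1 0]) ?mulr0 ?mul0r // !big_cons big_nil.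
by rewrite -[RHS]S0; apply: eq_bigr => k _; rewrite mul1r.
Qed.

Lemma dxi_transverse_eq0 (mH_neq0 : mH != 0) s n xi :
  dxi G [:: Fld (fA 1) (shell s); Fld (fA 1) (- shell s)] n xi = 0.
Proof.
set k : mom R := shell s.
pose w : seq (letter R) := [:: Fld (fA 1) k; Fld (fA 1) (- k); Chi].
have w0 : ptot w = 0 by rewrite /ptot !big_cons big_nil /= !addr0 subrr.
have := G_ST w n xi; rewrite slavnov_taylor_no_source // fmul_chi_even //.
have G_lor := vf_lorentz G_vertex.
have mix i : (forall n xi, fderiv (fphi i) G [:: Fld (fA 1) k] n xi = 0) /\
    (forall n xi, fderiv (fphi i) G [:: Fld (fA 1) (- k)] n xi = 0).
  split=> n' xi'; rewrite /fderiv /ptot big_seq1 /= ?opprK;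
    by have [] := transverse_mixing_eq0 _ _ i s n' xi' G_lor.
have ghost i u : \sum_(l <- u) gh l == 0 ->
    forall n xi, fderiv (fY i) G u n xi = 0.
  by move=> /eqP u0 n' xi'; rewrite /fderiv gh_eq0 // big_cons u0 addr0.
(* Ghost number forces [Chi] onto the [Y_1] factor. The four splits left contain the tadpole, one of
   the two mixings, or [Y_1] with [Chi] alone. *)
rewrite (fmul_eq0 R _ _ w) ?add0r; last first.
  move=> [|[] [|[] [|[] []]]] //= _; try by left; apply: ghost; rewrite ?big_cons big_nil.
  - by right => n' xi'; rewrite /fderiv /ptot big_nil oppr0 G_phi1.
  - by right => n' xi'; have [] := mix ord0.
  - by right => n' xi'; have [] := mix ord0.
  - left => n' xi'; rewrite /fderiv /ptot big_seq1 /= oppr0; exact: Y1_chi_eq0.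
(* The same splits for index 2, where charge conjugation replaces both the tadpole condition and the
   vanishing of the [Y_1], [Chi] function. *)
rewrite (fmul_eq0 R _ _ w) ?add0r //.
move=> [|[] [|[] [|[] []]]] //= _; try by left; apply: ghost; rewrite ?big_cons big_nil.
- by right => n' xi'; apply: Codd_eq0.
- by right => n' xi'; have [] := mix 1.
- by right => n' xi'; have [] := mix 1.
- by left => n' xi'; apply: Codd_eq0.
Qed.
End VertexFunctional.

(** * Componentwise complex derivatives *)

Lemma is_cderiveN (R : realType) (f : R -> R[i]%C) x l :
  is_cderive f x l -> is_cderive (fun t => - f t) x (- l).
Proof.
case=> -[dre dim] <-.
have reN : (fun t => complex.Re (- f t)) = - (fun t => complex.Re (f t)).
  by apply/funext => t /=; rewrite [RHS]/GRing.opp /=; case: (f t).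
have imN : (fun t => complex.Im (- f t)) = - (fun t => complex.Im (f t)).
  by apply/funext => t /=; rewrite [RHS]/GRing.opp /=; case: (f t).
split; first by rewrite /cderivable reN imN; split; apply: derivableN.
by rewrite /cderive reN imN !derive1N.
Qed.

Lemma is_cderive0_cst (R : realType) (f : R -> R[i]%C) :
  (forall x, is_cderive f x 0) -> forall x y, f x = f y.
Proof.
move=> f0 x y; apply/eqP; rewrite eq_complex; apply/andP; split; apply/eqP.
  apply: (@is_derive_0_is_cst R (fun t => complex.Re (f t))) => t.
  have [[dre _] [re0 _]] := f0 t.
  by apply: DeriveDef; rewrite // -derive1E re0.
apply: (@is_derive_0_is_cst R (fun t => complex.Im (f t))) => t.
have [[_ dim] [_ im0]] := f0 t.
by apply: DeriveDef; rewrite // -derive1E im0.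
Qed.

Lemma is_cderive_near (R : realType) (f g : R -> R[i]%C) x l :
  (\forall y \near x, f y = g y) -> is_cderive f x l -> is_cderive g x l.
Proof.
move=> fg [[dre dim] <-].
have re : \forall y \near x, complex.Re (f y) = complex.Re (g y).
  by apply: filterS fg => y ->.
have im : \forall y \near x, complex.Im (f y) = complex.Im (g y).
  by apply: filterS fg => y ->.
split.
  by split; [apply: near_eq_derivable re dre | apply: near_eq_derivable im dim].
rewrite /cderive !derive1E; congr (_ +i* _)%C; apply: esym; exact: near_eq_derive.
Qed.

(** Differentiability gives continuity, so both values are limits of the same function on a
    punctured neighbourhood. This serves at [p^2 = 0], where the decomposition is silent. *)
Lemma eq_punctured_derivable (R : realType) (f g : R -> R) (x : R) :
  derivable f x 1 -> derivable g x 1 -> (forall y, y != x -> f y = g y) ->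
  f x = g x.
Proof.
move=> /derivable1_diffP/differentiable_continuous fx.
move=> /derivable1_diffP/differentiable_continuous gx fg.
have fx' : (f y @[y --> x^'] --> f x)%classic.
  by apply: cvg_trans fx; apply: cvg_app; apply: cvg_within.
have gx' : (g y @[y --> x^'] --> g x)%classic.
  by apply: cvg_trans gx; apply: cvg_app; apply: cvg_within.
apply: (cvg_unique _ fx') => //; apply: cvg_trans gx'; apply: near_eq_cvg.
by near=> y; apply/esym/fg; near: y; apply: nbhs_dnbhs_neq.
Unshelve. all: by end_near. Qed.

Lemma eq_punctured_cderivable (R : realType) (f g : R -> R[i]%C) x :
  cderivable f x -> cderivable g x -> (forall y, y != x -> f y = g y) -> f = g.
Proof.
move=> [fre fim] [gre gim] fg; apply/funext => y.
have [->|/fg //] := eqVneq y x.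
apply/eqP; rewrite eq_complex; apply/andP; split; apply/eqP.
  by apply: (eq_punctured_derivable _ _ _ _ fre gre) => z /fg ->.
by apply: (eq_punctured_derivable _ _ _ _ fim gim) => z /fg ->.
Qed.

Theorem mainTheorem2 (R : realType) (m mH : R) (G : functional R)
    (m_gt0 : 0 < m) (mH_gt0 : 0 < mH) (higgs_stable : mH ^+ 2 < 4 * m ^+ 2)
    (G_vertex : vertex_functional mH G)
    (G_ST : forall w n xi, slavnov_taylor G w n xi = 0)
    (G_phi1 : forall n xi, G [:: Fld phi1 0] n xi = 0) :
  (forall n xi, dchi G [:: Fld Y1 0] n xi = 0) /\
  (exists T L : nat -> R -> R -> R[i]%C, vector_decomposition G T L) /\
  (forall T L : nat -> R -> R -> R[i]%C, vector_decomposition G T L ->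
    (forall n xi (s : R), s != 0 -> is_cderive (fun t => T n t s) xi 0) /\
    (forall xi0, mass_condition T m xi0 -> forall xi, mass_condition T m xi) /\
    (forall kappa2 xi0 : R,
      (kappa2 = 0 -> forall n xi, cderivable (T n xi) 0) ->
      residue_condition T kappa2 xi0 ->
      forall xi, residue_condition T kappa2 xi)).
Proof.
have mH_neq0 : mH != 0 by rewrite gt_eqF.
split; first by move=> n xi; apply: (Y1_chi_eq0 _ _ _ G_vertex).
split.
  by apply: vector_decomposition_exists; [apply: vf_lorentz | apply: vf_graded];
    exact: G_vertex.
move=> T L dec.
have dT n xi (s : R) : s != 0 -> is_cderive (fun t => T n t s) xi 0.
  move=> s_neq0; under eq_fun do rewrite (transversal_shell _ _ _ _ _ _ _ dec s_neq0).
  rewrite -oppr0; apply: is_cderiveN; split; first exact: (vf_xi G_vertex).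
  exact: (dxi_transverse_eq0 _ _ _ G_vertex).
have cstT n xi xi' (s : R) : s != 0 -> T n xi s = T n xi' s.
  by move=> s_neq0; apply: (is_cderive0_cst _ (fun t => T n t s)) => t; apply: dT.
split=> //; split=> [xi0 mass xi n|kappa2 xi0 dkappa res xi n].
  by rewrite (cstT n xi xi0) // expf_neq0 // gt_eqF.
have [k0|k_neq0] := eqVneq kappa2 0; last first.
  (* Nonzero [s] form an open set around [kappa2], on which the functions for [xi] and [xi0]
     coincide. *)
  apply: is_cderive_near (res n); near=> s; apply: cstT.
  by near: s; apply: open_nbhs_nbhs; split=> //; apply: open_neq.
(* At [kappa2 = 0] the two functions agree off the origin; [dkappa] makes both differentiable there,
   so they agree everywhere. *)
rewrite (_ : T n xi = T n xi0) //; apply: (@eq_punctured_cderivable _ _ _ 0).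
- exact: dkappa.
- exact: dkappa.
- by move=> s; apply: cstT.
Unshelve. all: by end_near. Qed.
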